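(* Let $n\in\mathbb N$ and let $x>0$ with $x\in\mathcal D_n\setminus\bigcup_{k=1}^{n-1}\mathcal D_k$. Then $q_s(x)\in(q_{n-1},q_n]$, and $q_s(x)$ is the root $q\in(q_{n-1},q_n]$ of the equation $$x=\sum_{i=1}^\infty\frac{\gamma_i}{q^i},$$ where $(\gamma_i)$ is the lexicographically smallest sequence in $\mathcal U_{q_n}'$ such that $((\gamma_i))_{q_{n-1}}>x$.
   Context: $\mathbb N=\{1,2,\dots\}$. For a sequence $(d_i)=d_1d_2\cdots$ of zeros and ones and a real $q\ge1$ write $((d_i))_q:=\sum_{i=1}^\infty d_i q^{-i}$ (for $q=1$ this is the possibly infinite value $\sum_i d_i\in[0,+\infty]$). For $q\in(1,2)$, $(d_i)\in\{0,1\}^{\mathbb N}$ is a $q$-expansion of $x$ if $x=((d_i))_q$. For $x>0$ let $\mathcal U(x)$ be the set of $q\in(1,2)$ such that $x$ has exactly one $q$-expansion, and $q_s(x):=\inf\mathcal U(x)$. For $q\in(1,2)$ let $\mathcal U_q$ be the set of $x\in[0,1/(q-1)]$ having exactly one $q$-expansion, and let $\mathcal U_q'\subset\{0,1\}^{\mathbb N}$ be the set of the corresponding (unique) $q$-expansions. Let $(\tau_i)_{i\ge0}$ be the classical Thue–Morse sequence: $\tau_0=0$, $\tau_{2^m}=1$ for $m\ge0$, and $\tau_{2^m+j}=1-\tau_j$ for $1\le j<2^m$. Let $q_0=1$ and, for $n\ge1$, let $q_n\in(1,2)$ be the root of $1=\sum_{i=1}^{2^n}\tau_i q^{-i}$;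 the sequence $(q_n)$ is strictly increasing. For $n\in\mathbb N$ put $\mathcal D_n:=\bigcup_{q_{n-1}<q\le q_n}\mathcal U_q$. Sequences are compared lexicographically. *)

(* Defs.v *)
From HB Require Import structures.
From mathcomp Require Import all_boot all_order all_algebra.
From mathcomp Require Import all_classical all_reals all_analysis.

Set Implicit Arguments.
Unset Strict Implicit.
Unset Printing Implicit Defensive.
Import Order.TTheory GRing.Theory Num.Theory.
Local Open Scope classical_set_scope.
Local Open Scope ring_scope.

(* Sequences of zeros and ones, stored from index 0: [d i] is the digit
   d_{i+1}, so that the type has no junk entry and Leibniz equality is equality
   of the sequences. *)
Definition binseq := nat -> bool.

(* Extended-real valued because the sum may be infinite when q = 1. *)
Definition expansion_value (R : realType) (d : binseq) (q : R) : \bar R :=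
  (\sum_(0 <= i <oo) ((d i)%:R / q ^+ i.+1)%:E)%E.

Definition is_expansion (R : realType) (q x : R) (d : binseq) : Prop :=
  x%:E = expansion_value d q.

Definition unique_expansion (R : realType) (q x : R) : Prop :=
  exists! d : binseq, is_expansion q x d.

Definition univoque_bases (R : realType) (x : R) : set R :=
  [set q | 1 < q < 2 /\ unique_expansion q x].

Definition smallest_univoque_base (R : realType) (x : R) : R :=
  inf (univoque_bases x).

Definition univoque_set (R : realType) (q : R) : set R :=
  [set x | 0 <= x <= 1 / (q - 1) /\ unique_expansion q x].

Definition univoque_sequences (R : realType) (q : R) : set binseq :=
  [set d | exists2 x, univoque_set q x & is_expansion q x d].

(* For i > 0, [2 ^ trunc_log 2 i] is the largest power 2^m <= i; the clauses
   tau_{2^m} = 1 and tau_{2^m+j} = 1 - tau_j merge since tau_0 = 0. The first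
   argument is fuel; [i] is always enough. *)
Fixpoint thue_morse_rec (fuel i : nat) : bool :=
  if fuel is f.+1 then
    if i == 0%N then false else ~~ thue_morse_rec f (i - 2 ^ trunc_log 2 i)%N
  else false.

Definition thue_morse (i : nat) : bool := thue_morse_rec i i.

Lemma thue_morse_rec_fuel f i :
  (i <= f)%N -> thue_morse_rec f i = thue_morse i.
Proof.
suff H g h j : (j <= g)%N -> (j <= h)%N ->
    thue_morse_rec g j = thue_morse_rec h j by move=> lif; exact: H.
elim: g h j => [|g IH] [|h] j //=; rewrite ?leqn0.
- by move=> ->.
- by move=> _ ->.
case: eqP => // /eqP; rewrite -lt0n => j0 jg jh; congr (~~ _).
have p0 : (0 < 2 ^ trunc_log 2 j)%N by rewrite expn_gt0.
have lt : (j - 2 ^ trunc_log 2 j < j)%N by rewrite ltn_subrL p0 j0.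
by apply: IH; rewrite -ltnS; apply: leq_trans lt _.
Qed.

Lemma thue_morse0 : thue_morse 0 = false.
Proof. by []. Qed.

Lemma thue_morse_add m j :
  (j < 2 ^ m)%N -> thue_morse (2 ^ m + j) = ~~ thue_morse j.
Proof.
move=> jm.
have p0 : (0 < 2 ^ m)%N by rewrite expn_gt0.
have -> : thue_morse (2 ^ m + j) = thue_morse_rec (2 ^ m + j).-1.+1 (2 ^ m + j).
  by rewrite prednK // addn_gt0 p0.
rewrite /= addn_eq0 eqn0Ngt p0 /=.
have -> : trunc_log 2 (2 ^ m + j) = m.
  by apply: trunc_log_eq => //; rewrite leq_addr expnS mul2n -addnn ltn_add2l.
rewrite addKn thue_morse_rec_fuel // -ltnS prednK ?addn_gt0 ?p0 //.
by rewrite -[X in (X < _)%N]add0n ltn_add2r.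
Qed.

Lemma thue_morse_exp m : thue_morse (2 ^ m) = true.
Proof. by rewrite -[(2 ^ m)%N]addn0 thue_morse_add ?expn_gt0. Qed.

(* For n > 0 the set below is a singleton: the sum is decreasing in q, at least
   2 at q = 1 and less than 1 at q = 2; so the default value is never used. *)
Definition tm_base (R : realType) (n : nat) : R :=
  if n is 0%N then 1
  else xget 1 [set q : R | 1 < q < 2 /\
    1 = \sum_(1 <= i < (2 ^ n).+1) (thue_morse i)%:R / q ^+ i].

(* Meaningful for n > 0 only. *)
Definition univoque_layer (R : realType) (n : nat) : set R :=
  \bigcup_(q in [set q : R | tm_base R n.-1 < q <= tm_base R n])
    univoque_set q.

Definition lex_lt (d e : binseq) : Prop :=
  exists k, (forall i, (i < k)%N -> d i = e i) /\ d k = false /\ e k = true.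

Definition lex_le (d e : binseq) : Prop := d = e \/ lex_lt d e.

Definition lex_smallest (S : set binseq) (g : binseq) : Prop :=
  S g /\ forall d, S d -> lex_le g d.

(* Main.v *)
Require Import Defs.
From HB Require Import structures.
From mathcomp Require Import all_boot all_order all_algebra.
From mathcomp Require Import all_classical all_reals all_analysis.
From mathcomp Require Import zify ring lra.

(* A sequence d is the unique q-expansion of its value iff after each digit 0
   (resp. 1) the remaining sequence (resp. its complement) has value < 1 in base
   q. For q in (q_m, q_{m+1}] this is equivalent to a condition not involving q:
   after each 0 (resp. 1) the next 2^m digits (resp. their complement) form a
   word smaller than tau_1 ... tau_{2^m}. Hence q in (q_m, q_{m+1}] is univoque
   for x iff x is the value in base q of a sequence d of this kind. Values of
   such sequences increase lexicographically and decrease with q, so the smallest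
   such base belongs to the smallest sequence with value > x at q_m. *)

Set Implicit Arguments.
Unset Strict Implicit.
Unset Printing Implicit Defensive.
Import Order.TTheory GRing.Theory Num.Theory.
Import numFieldNormedType.Exports.
Local Open Scope classical_set_scope.

(** * Thue-Morse words *)

(** Removing the leading power of 2 commutes with doubling and flips both sides, so induction on [i]
    applies. *)
Lemma thue_morse_double i :
  (thue_morse i.*2 = thue_morse i) * (thue_morse i.*2.+1 = ~~ thue_morse i).
Proof.
elim/ltn_ind: i => i IH; case: (posnP i) => [->//|i0].
have := trunc_log_bounds (isT : (1 < 2)%N) i0; set m := trunc_log 2 i.
move=> /andP[mi im].
have ji : (i - 2 ^ m < 2 ^ m)%N by rewrite ltn_subLR // addnn -mul2n -expnS.
have p0 : (0 < 2 ^ m)%N by rewrite expn_gt0.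
have jlt : (i - 2 ^ m < i)%N by rewrite ltn_subrL p0.
have [IH1 IH2] := IH _ jlt.
move: ji IH1 IH2; set j := (i - 2 ^ m)%N => ji IH1 IH2.
have -> : i = (2 ^ m + j)%N by rewrite subnKC.
rewrite doubleD -mul2n -expnS -addnS !thue_morse_add ?IH1 ?IH2 //;
  rewrite expnS mul2n ?ltn_double //.
by rewrite ltn_Sdouble.
Qed.

(* The shifts of tau_1 tau_2 ... are lexicographically at most tau_1 tau_2 ...;
   for odd [m] the words differ within two letters since tau_1 = tau_2 = 1. *)
Lemma thue_morse_shift_lt m i : (0 < i)%N ->
  (forall j, (0 < j < i)%N -> thue_morse (m + j) = thue_morse j) ->
  thue_morse (m + i) != thue_morse i -> thue_morse i.
Proof.
elim/ltn_ind: i m => i IH m i0 agree.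
case: (boolP (odd m)) => om.
  have [|i2] := leqP i 2; first by case: i i0 {IH agree} => [|[|[|]]].
  have e1 := agree 1%N (ltnW i2); have e2 := agree 2%N i2.
  have me : m = (m./2).*2.+1 by lia.
  have a1 : (m + 1)%N = (m./2.+1).*2 by lia.
  have a2 : (m + 2)%N = (m./2.+1).*2.+1 by lia.
  by move: e1 e2; rewrite a1 a2 !thue_morse_double => ->.
have me : m = (m./2).*2 by lia.
case: (boolP (odd i)) => oi.
  have ie : i = (i./2).*2.+1 by lia.
  have [z|i20] := posnP i./2; first by rewrite ie z.
  rewrite {1}me {1 2}ie addnS -doubleD !thue_morse_double.
  have := agree (i./2).*2; rewrite {1}me -doubleD !thue_morse_double => ->.
    by rewrite eqxx.
  lia.
have ie : i = (i./2).*2 by lia.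
rewrite {1}me ie -doubleD !thue_morse_double.
apply: IH => [||j jlt]; [lia|lia|].
have := agree j.*2; rewrite {1}me -doubleD !thue_morse_double; apply; lia.
Qed.

(** * Tails of a sequence and the Thue-Morse bound *)

Definition tmw : binseq := fun i => thue_morse i.+1.

Lemma tmw_last m : tmw (2 ^ m).-1 = true.
Proof. by rewrite /tmw prednK ?expn_gt0 // thue_morse_exp. Qed.

(** The place [(2 ^ m).-1] is left out: there both digits are 1, being values of tau at powers of
    2. *)
Lemma tmw_add m i : (i < (2 ^ m).-1)%N -> tmw (2 ^ m + i) = ~~ tmw i.
Proof. by move=> im; rewrite /tmw -addnS thue_morse_add //; lia. Qed.

(* The digits following [d k], complemented when [d k] is 1: both halves of the
   usual conditions on univoque sequences then read alike. *)
Definition rtail (d : binseq) (k : nat) : binseq :=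
  fun i => d (k + i.+1)%N (+) d k.

(** A digit 0 of [rtail d k] marks a digit equal to [d k], so the tail restarted there has the same
    complementation; a digit 1 reverses it in [rtail_addN]. *)
Lemma rtail_add d k j i : rtail d k j = false ->
  rtail d k (j.+1 + i) = rtail d (k + j.+1) i.
Proof.
rewrite /rtail -[(j.+1 + i).+1]addnS addnA.
by case: (d (k + j.+1)); case: (d k).
Qed.

Lemma rtail_addN d k j i : rtail d k j = true ->
  rtail d k (j.+1 + i) = ~~ rtail d (k + j.+1) i.
Proof.
rewrite /rtail -[(j.+1 + i).+1]addnS addnA.
by case: (d (k + j.+1)); case: (d k); case: (d _).
Qed.

(* [tmw] lies above [rtail d k] lexicographically, already on 2^m digits. *)
Definition tm_bounded (m : nat) (d : binseq) : Prop :=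
  forall k, exists j, [/\ (j < 2 ^ m)%N, forall i, (i < j)%N -> rtail d k i = tmw i,
    tmw j = true & rtail d k j = false].

(* The same condition, as a bound by tau_1 ... tau_{2^m - 1} 0. *)
Lemma tm_boundedP m d : tm_bounded m d <->
  forall k j, (j < 2 ^ m)%N -> (forall i, (i < j)%N -> rtail d k i = tmw i) ->
    tmw j = false \/ j = (2 ^ m).-1 -> rtail d k j = false.
Proof.
split=> [bd k j jm agree tj|H k].
  have [l [lm agl tl rl]] := bd k.
  case: (ltngtP j l) => [jl|lj|->//].
    case: tj => [<-|tj]; [exact: agl|lia].
  by move: (agree _ lj); rewrite tl rl.
have ex : exists j, (j < 2 ^ m)%N && (rtail d k j != tmw j).
  apply: contrapT => nex.
  have agree j : (j < 2 ^ m)%N -> rtail d k j = tmw j.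
    by move=> jm; apply/eqP/negPn/negP => ne; apply: nex; exists j; rewrite jm.
  have p0 : (0 < 2 ^ m)%N by rewrite expn_gt0.
  have lt : ((2 ^ m).-1 < 2 ^ m)%N by rewrite prednK.
  have := H k _ lt; rewrite agree // tmw_last => /(_ _ (or_intror erefl)).
  have h : forall i, (i < (2 ^ m).-1)%N -> rtail d k i = tmw i.
    by move=> i il; apply: agree; apply: ltn_trans lt.
  by move=> /(_ h).
case: (ex_minnP ex) => j /andP[jm ne] jmin; exists j.
have agree i : (i < j)%N -> rtail d k i = tmw i.
  move=> ij; apply/eqP/negPn/negP => nei; move: (jmin i); rewrite nei.
  by rewrite (ltn_trans ij jm) leqNgt ij => /(_ isT).
have tj : tmw j = true.
  case: (boolP (tmw j)) => // /negbTE tj.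
  by have := H k j jm agree (or_introl tj); move: ne; rewrite tj; case: rtail.
by split=> //; move: ne; rewrite tj; case: rtail.
Qed.

Lemma rtail_block_add m d k i :
  (forall i, (i < 2 ^ m)%N -> rtail d k i = tmw i) ->
  rtail d k (2 ^ m + i) = ~~ rtail d (k + 2 ^ m) i.
Proof.
have p0 : (0 < 2 ^ m)%N by rewrite expn_gt0.
move=> bk; rewrite -[in LHS](prednK p0) rtail_addN ?prednK //.
by rewrite bk ?tmw_last ?prednK.
Qed.

(* If the bound fails at level [m] but holds at level [m.+1], the digits are
   forced: after w = tau_1 ... tau_{2^m} comes its complement, then w, etc. *)
Lemma tm_block_next m d k : tm_bounded m.+1 d ->
  (forall i, (i < 2 ^ m)%N -> rtail d k i = tmw i) ->
  forall i, (i < 2 ^ m)%N -> rtail d (k + 2 ^ m) i = tmw i.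
Proof.
move=> /tm_boundedP bd bk.
have p0 : (0 < 2 ^ m)%N by rewrite expn_gt0.
have e2 : (2 ^ m.+1 = 2 ^ m + 2 ^ m)%N by rewrite expnS mul2n addnn.
have nx i := rtail_block_add i bk.
elim/ltn_ind => i IH im.
(* A digit 0 is forced by the bound on the tail at [k + 2 ^ m], a digit 1 by the bound on the tail
   at [k], where it appears complemented. *)
case: (boolP (tmw i)) => ti; last first.
  apply: bd => [|j ji|]; [lia|by apply: IH => //; lia|left; exact/negbTE].
suff : rtail d k (2 ^ m + i) = false by rewrite nx; case: rtail.
apply: bd => [|j ji|]; first lia.
  have [jm|mj] := ltnP j (2 ^ m); first exact: bk.
  rewrite -(subnKC mj) nx IH ?tmw_add ?negbK //; lia.
have [->|ne] := eqVneq i (2 ^ m).-1; first by right; lia.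
by left; rewrite tmw_add ?ti //; lia.
Qed.

(** The complemented second block continues tau_1 tau_2 ... up to its last place, where it has 0 and
    tau_{2^(m+1)} = 1. *)
Lemma tm_block_double m d k : tm_bounded m.+1 d ->
  (forall i, (i < 2 ^ m)%N -> rtail d k i = tmw i) ->
  (forall i, (i < (2 ^ m.+1).-1)%N -> rtail d k i = tmw i) /\
  rtail d k (2 ^ m.+1).-1 = false.
Proof.
move=> bd bk; have bn := tm_block_next bd bk.
have p0 : (0 < 2 ^ m)%N by rewrite expn_gt0.
have e2 : (2 ^ m.+1 = 2 ^ m + 2 ^ m)%N by rewrite expnS mul2n addnn.
have nx i := rtail_block_add i bk.
split=> [i il|].
  have [im|mi] := ltnP i (2 ^ m); first exact: bk.
  by rewrite -(subnKC mi) nx bn ?tmw_add; lia.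
have -> : (2 ^ m.+1).-1 = (2 ^ m + (2 ^ m).-1)%N by lia.
by rewrite nx bn ?tmw_last ?prednK.
Qed.

(** Where level [m] fails, no first deviation from [tmw] is possible: level [m.+1] excludes an
    upward one, the failure a downward one. *)
Lemma tm_block_of_not_bounded m d : tm_bounded m.+1 d -> ~ tm_bounded m d ->
  exists k, forall i, (i < 2 ^ m)%N -> rtail d k i = tmw i.
Proof.
move=> /tm_boundedP bd; move=> /existsNP[k nk]; exists k.
have p0 : (0 < 2 ^ m)%N by rewrite expn_gt0.
have e2 : (2 ^ m.+1 = 2 ^ m + 2 ^ m)%N by rewrite expnS mul2n addnn.
elim/ltn_ind => i IH im.
have ag j : (j < i)%N -> rtail d k j = tmw j by move=> ji; apply: IH => //; lia.
case: (boolP (tmw i)) => ti; last first.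
  apply: bd => //; [lia|left; exact/negbTE].
by case: (boolP (rtail d k i)) => // /negbTE ri; case: nk; exists i.
Qed.

Lemma tm_blocks m d k s : tm_bounded m.+1 d ->
  (forall i, (i < 2 ^ m)%N -> rtail d k i = tmw i) ->
  forall i, (i < 2 ^ m)%N -> rtail d (k + s * 2 ^ m) i = tmw i.
Proof.
move=> bd bk; elim: s => [|s IH]; first by rewrite mul0n addn0.
by rewrite mulSnr addnA; apply: tm_block_next.
Qed.

(** A prefix containing one full block determines all later digits, by [tm_blocks]. *)
Lemma tm_bounded_isolated m d : tm_bounded m.+1 d -> ~ tm_bounded m d ->
  exists K, forall e, tm_bounded m.+1 e ->
    (forall i, (i < K)%N -> e i = d i) -> e = d.
Proof.
move=> bd nbd; have [k bk] := tm_block_of_not_bounded bd nbd.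
exists (k + 2 ^ m).+1 => e be agree.
have p0 : (0 < 2 ^ m)%N by rewrite expn_gt0.
have bek i : (i < 2 ^ m)%N -> rtail e k i = tmw i.
  by move=> im; rewrite -bk // /rtail !agree //; lia.
have H s i : (i <= k + s * 2 ^ m)%N -> e i = d i.
  elim: s i => [|s IH] i; first by rewrite mul0n addn0 => ik; apply: agree; lia.
  rewrite mulSnr addnA => ile.
  have [il|il] := leqP i (k + s * 2 ^ m); first exact: IH.
  have im : (i - (k + s * 2 ^ m).+1 < 2 ^ m)%N by lia.
  have := tm_blocks s be bek im; rewrite -(tm_blocks s bd bk im) /rtail.
  by rewrite addnS -addSn subnKC // (IH (k + s * 2 ^ m)) //; case: (e i); case: (d i); case: (d _).
apply/funext => i; apply: (H i).
by rewrite (leq_trans _ (leq_addl _ _)) // leq_pmulr.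
Qed.

(** At level 0 each digit equals its predecessor, so only constant sequences remain. *)
Lemma tm_bounded0_eq d e : tm_bounded 0 d -> tm_bounded 0 e -> d 0%N = e 0%N -> d = e.
Proof.
have C f k : tm_bounded 0 f -> f k = f 0%N.
  move=> /(_ _) bf; elim: k => // k <-; have [j []] := bf k.
  rewrite ltnS leqn0 => /eqP-> _ _; rewrite /rtail addn1.
  by case: (f k); case: (f k.+1).
by move=> bd be de; apply/funext => k; rewrite C // de -(C e k).
Qed.

(* A condition on finitely many digits at a time passes to limits. *)
Lemma tm_bounded_closed m g :
  (forall K, exists2 d, tm_bounded m d & forall i, (i < K)%N -> d i = g i) ->
  tm_bounded m g.
Proof.
move=> H k; have [d bd dg] := H (k + 2 ^ m).+1.
have [j [jm ag tj rj]] := bd k; exists j.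
have E i : (i <= j)%N -> rtail d k i = rtail g k i.
  by move=> ij; rewrite /rtail !dg //; lia.
by split=> // [i ij|]; [rewrite -E ?ag // ltnW|rewrite -E].
Qed.

(* A lexicographic infimum: each prefix of it is a prefix of an element. *)
Lemma lex_inf_exists (S : set binseq) : S !=set0 ->
  exists g, (forall K, exists2 d, S d & forall i, (i < K)%N -> d i = g i) /\
            (forall d, S d -> lex_le g d).
Proof.
move=> [d0 Sd0].
pose ext (p : seq bool) := `[<exists2 d, S d & forall i, (i < size p)%N -> d i = nth false p i>].
(* Greedy choice: append 0 if some element of [S] allows it, and 1 otherwise. *)
pose step p := rcons p (~~ ext (rcons p false)).
pose pre K := iter K step [::].
have szp K : size (pre K) = K by elim: K => //= K IH; rewrite size_rcons IH.
pose g : binseq := fun i => nth false (pre i.+1) i.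
have gp K i : (i < K)%N -> nth false (pre K) i = g i.
  elim: K => // K IH; rewrite ltnS leq_eqVlt => /predU1P[->//|iK].
  by rewrite /= nth_rcons szp iK IH.
have extp K : ext (pre K).
  elim: K => [|K /asboolP[d Sd dp]]; first by apply/asboolP; exists d0.
  rewrite /= /step; case: (boolP (ext (rcons (pre K) false))) => //= ne.
  apply/asboolP; exists d => // i; rewrite size_rcons szp ltnS nth_rcons szp.
  move=> iK; case: ltngtP iK => // [iK _|-> _]; first by apply: dp; rewrite szp.
  case E: (d K) => //; case/negP: ne; apply/asboolP; exists d => // j.
  rewrite size_rcons szp ltnS nth_rcons szp leq_eqVlt.
  by case/predU1P => [->|jK]; rewrite ?ltnn ?eqxx // jK dp ?szp.
exists g; split=> [K|d Sd].
  have /asboolP[d Sd dp] := extp K; exists d => // i iK.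
  by rewrite dp ?szp // gp.
have [->|ne] := pselect (d = g); first by left.
right.
have ex : exists i, d i != g i.
  apply: contrapT => nex; apply: ne; apply/funext => i.
  by apply/eqP/negPn/negP => h; apply: nex; exists i.
case: (ex_minnP ex) => k nk kmin.
have ag i : (i < k)%N -> g i = d i.
  move=> ik; apply/eqP; rewrite eq_sym; apply/negPn/negP => h.
  by have := kmin _ h; rewrite leqNgt ik.
exists k; split=> //.
(* If [g k] were 1, then [d k] would be 0 and [d] would show that 0 could have been appended. *)
suff gk : g k = false by split=> //; move: nk; rewrite gk; case: (d k).
case dk: (d k) nk => // => [|nk]; first by case: (g k).
have : g k = true by move: nk; case: (g k).
rewrite /g /= nth_rcons szp ltnn eqxx => /negP[]; apply/asboolP; exists d => // j.
rewrite size_rcons szp ltnS nth_rcons szp leq_eqVlt.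
by case/predU1P => [->|jk]; rewrite ?ltnn ?eqxx // jk gp // ag.
Qed.

(** * Values of expansions *)

Local Open Scope ring_scope.

Lemma le_of_le_add_geometric (R : realType) (a b C q : R) : 1 < q ->
  (forall K, a <= b + C / q ^+ K) -> a <= b.
Proof.
move=> q1 H.
have q0 : 0 < q by lra.
have cv : (fun K => b + C * q^-1 ^+ K) @ \oo --> b + 0.
  apply: cvgD; first exact: cvg_cst.
  by apply: cvg_geometric; rewrite ger0_norm ?invr_ge0 ?ltW // invf_lt1.
rewrite -[b]addr0 -(cvg_lim _ cv) //; apply: limr_ge; first by apply/cvg_ex; exists (b + 0).
by near=> K; rewrite exprVn.
Unshelve. all: by end_near.
Qed.

Definition psum (R : realType) (d : binseq) (q : R) (K : nat) : R :=
  \sum_(0 <= i < K) (d i)%:R / q ^+ i.+1.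

(** For q > 1 the value is finite and [fine] loses nothing; an infinite value would be sent to 0. *)
Definition expansion_real (R : realType) (d : binseq) (q : R) : R :=
  fine (expansion_value d q).

Definition tail_from (d : binseq) (k : nat) : binseq := fun i => d (k + i)%N.

Definition flip (d : binseq) : binseq := fun i => ~~ d i.

Section PartialSums.
Variable R : realType.
Implicit Types (d e : binseq) (q p x y : R) (K k : nat).

Lemma psumS d q K : psum d q K.+1 = psum d q K + (d K)%:R / q ^+ K.+1.
Proof. by rewrite /psum big_nat_recr. Qed.

Lemma psum0 d q : psum d q 0 = 0.
Proof. by rewrite /psum big_nil. Qed.

Lemma eq_psum d e q K : (forall i, (i < K)%N -> d i = e i) -> psum d q K = psum e q K.
Proof. by move=> H; apply: eq_big_nat => i /andP[_ iK]; rewrite H. Qed.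

Lemma psum_add d q K L : 0 < q ->
  psum d q (K + L) = psum d q K + psum (tail_from d K) q L / q ^+ K.
Proof.
move=> q0; elim: L => [|L IH]; first by rewrite addn0 psum0 mul0r addr0.
rewrite addnS !psumS IH mulrDl addrA /tail_from -addnS exprD; congr (_ + _).
by rewrite invfM mulrA mulrAC.
Qed.

Lemma psum_le_mono d q K L : 0 < q -> (K <= L)%N -> psum d q K <= psum d q L.
Proof.
move=> q0 /subnKC <-; elim: (L - K)%N => [|n IH]; first by rewrite addn0.
by rewrite addnS psumS (le_trans IH) // lerDl divr_ge0 ?exprn_ge0 // ltW.
Qed.

Lemma psum_ge0 d q K : 0 < q -> 0 <= psum d q K.
Proof. by move=> q0; rewrite -(psum0 d q) psum_le_mono. Qed.

Lemma psum_flip d q K : 1 < q ->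
  psum d q K + psum (flip d) q K = (1 - 1 / q ^+ K) / (q - 1).
Proof.
move=> q1; have q0 : q != 0 by rewrite gt_eqF //; lra.
have q10 : q - 1 != 0 by rewrite gt_eqF //; lra.
elim: K => [|K IH]; first by rewrite !psum0 expr0; field.
rewrite !psumS addrACA IH -mulrDl /flip.
have -> : ((d K)%:R + (~~ d K)%:R : R) = 1 by case: (d K); rewrite ?addr0 ?add0r.
rewrite exprS; field.
by rewrite q10 expf_neq0 ?q0.
Qed.

Lemma psum_le_max d q K : 1 < q -> psum d q K <= 1 / (q - 1).
Proof.
move=> q1; have q0 : 0 < q by lra.
have := psum_flip d K q1; have := psum_ge0 (flip d) K q0 => h e.
have qi : 0 <= 1 / q ^+ K by rewrite divr_ge0 // exprn_ge0 // ltW.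
apply: (@le_trans _ _ ((1 - 1 / q ^+ K) / (q - 1))); first lra.
by rewrite ler_pM2r ?invr_gt0; lra.
Qed.

Lemma psum_antimono d p q K : 0 < p -> p <= q -> psum d q K <= psum d p K.
Proof.
move=> p0 pq; apply: ler_sum => i _; rewrite ler_wpM2l //.
by rewrite lef_pV2 ?posrE ?exprn_gt0 ?lerXn2r ?nnegrE //; lra.
Qed.

(** The gain from one digit 1 does not depend on [K], so strictness survives the limit. *)
Lemma psum_gap d p q k K : 0 < p -> p <= q -> d k -> (k < K)%N ->
  psum d q K + (1 / p ^+ k.+1 - 1 / q ^+ k.+1) <= psum d p K.
Proof.
move=> p0 pq dk; elim: K => // K IH; rewrite ltnS leq_eqVlt => /predU1P[<-|kK].
  by rewrite !psumS dk /=; have := psum_antimono d k p0 pq; lra.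
rewrite !psumS; have := IH kK.
have : (d K)%:R / q ^+ K.+1 <= (d K)%:R / p ^+ K.+1.
  rewrite ler_wpM2l // lef_pV2 ?posrE ?exprn_gt0 ?lerXn2r ?nnegrE //; lra.
lra.
Qed.

Lemma psum_strict_antimono d p q k K : 0 < p -> p < q -> d k -> (k < K)%N ->
  psum d q K < psum d p K.
Proof.
move=> p0 pq dk kK; have := psum_gap p0 (ltW pq) dk kK.
suff : 1 / q ^+ k.+1 < 1 / p ^+ k.+1 by lra.
by rewrite !div1r ltf_pV2 ?posrE ?exprn_gt0 ?ltrXn2r ?nnegrE //; lra.
Qed.

(* A partial sum is a polynomial in 1/q. *)
Lemma psum_ivt d p q y K : 0 < p -> p <= q -> psum d q K <= y <= psum d p K ->
  exists2 r, p <= r <= q & psum d r K = y.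
Proof.
move=> p0 pq /andP[yq yp].
pose P : {poly R} := \sum_(0 <= i < K) (d i)%:R *: 'X^(i.+1) - y%:P.
have hP r : P.[r^-1] = psum d r K - y.
  rewrite hornerD hornerN hornerC horner_sum; congr (_ - _).
  by apply: eq_bigr => i _; rewrite hornerZ hornerXn exprVn.
have [||z /andP[z1 z2] /rootP] := @poly_ivt _ P q^-1 p^-1.
- by rewrite lef_pV2 ?posrE //; lra.
- by rewrite !hP; apply/andP; split; lra.
have q0 : 0 < q by lra.
have z0 : 0 < z by apply: lt_le_trans z1; rewrite invr_gt0.
rewrite -[z]invrK hP => /eqP; rewrite subr_eq0 => /eqP ez; exists z^-1 => //.
by rewrite -[p]invrK -[q]invrK !lef_pV2 ?posrE ?invr_gt0 // z1 z2.
Qed.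

Lemma psum_le_value d q K : 0 < q -> ((psum d q K)%:E <= expansion_value d q)%E.
Proof.
move=> q0; rewrite /psum -sumEFin; apply: nneseries_lim_ge => i _ _.
by rewrite lee_fin divr_ge0 // exprn_ge0 // ltW.
Qed.

Lemma value_le d q y : 0 < q -> (forall K, psum d q K <= y) ->
  (expansion_value d q <= y%:E)%E.
Proof.
move=> q0 H; apply: lime_le.
  apply: is_cvg_nneseries => i _ _.
  by rewrite lee_fin divr_ge0 // exprn_ge0 // ltW.
by near=> K; rewrite sumEFin lee_fin; exact: H.
Unshelve. all: by end_near.
Qed.

Lemma expansion_valueE d q : 1 < q -> expansion_value d q = (expansion_real d q)%:E.
Proof.
move=> q1; have q0 : 0 < q by lra.
rewrite fineK // ge0_fin_numE.
  by apply: le_lt_trans (ltry (1 / (q - 1))); apply: value_le => // K; exact: psum_le_max.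
by apply: le_trans (psum_le_value d 0 q0); rewrite psum0.
Qed.

Lemma psum_le_real d q K : 1 < q -> psum d q K <= expansion_real d q.
Proof.
by move=> q1; rewrite -lee_fin -expansion_valueE // psum_le_value //; lra.
Qed.

Lemma expansion_real_le d q y : 1 < q -> (forall K, psum d q K <= y) -> expansion_real d q <= y.
Proof.
by move=> q1 H; rewrite -lee_fin -expansion_valueE // value_le //; lra.
Qed.

Lemma expansion_real_ge0 d q : 1 < q -> 0 <= expansion_real d q.
Proof. by move=> q1; rewrite -(psum0 d q) psum_le_real. Qed.

Lemma expansion_real_le_max d q : 1 < q -> expansion_real d q <= 1 / (q - 1).
Proof. by move=> q1; apply: expansion_real_le => // K; exact: psum_le_max. Qed.

Lemma expansion_real_add d q K : 1 < q ->
  expansion_real d q = psum d q K + expansion_real (tail_from d K) q / q ^+ K.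
Proof.
move=> q1; have q0 : 0 < q by lra.
have qK : 0 < q ^+ K by rewrite exprn_gt0.
apply/eqP; rewrite eq_le; apply/andP; split.
  apply: expansion_real_le => // M; apply: (le_trans (psum_le_mono d q0 (leq_addl K M))).
  by rewrite psum_add // lerD2l ler_pM2r ?invr_gt0 // psum_le_real.
rewrite -lerBrDl ler_pdivrMr //; apply: expansion_real_le => // L.
rewrite -ler_pdivrMr // lerBrDl -psum_add //; exact: psum_le_real.
Qed.

Lemma expansion_real_le_psum d q K : 1 < q ->
  expansion_real d q <= psum d q K + 1 / (q - 1) / q ^+ K.
Proof.
move=> q1; rewrite (expansion_real_add d K) // lerD2l ler_wpM2r ?expansion_real_le_max //.
by rewrite invr_ge0 exprn_ge0 //; lra.
Qed.

Lemma expansion_real_flip d q : 1 < q ->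
  expansion_real (flip d) q = 1 / (q - 1) - expansion_real d q.
Proof.
move=> q1; apply/eqP; rewrite eq_le; apply/andP; split.
  apply: expansion_real_le => // K; have := psum_flip d K q1; have := expansion_real_le_psum d K q1.
  rewrite mulrBl [1 / q ^+ K / _]mulrAC; lra.
apply: (@le_of_le_add_geometric _ _ _ (1 / (q - 1)) q) => // K.
have := psum_flip d K q1; have := psum_le_real d K q1.
have := psum_le_real (flip d) K q1.
rewrite mulrBl [1 / q ^+ K / _]mulrAC; lra.
Qed.

Lemma expansion_real_eq_of_psum d q x (r : nat -> R) : 1 < q ->
  (forall K, 0 <= r K <= 1 / (q - 1)) ->
  (forall K, x = psum d q K + r K / q ^+ K) -> expansion_real d q = x.
Proof.
move=> q1 rb H; have q0 : 0 < q by lra.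
have qK K : 0 <= (q ^+ K)^-1 by rewrite invr_ge0 exprn_ge0 // ltW.
apply/eqP; rewrite eq_le; apply/andP; split.
  apply: expansion_real_le => // K; rewrite (H K) lerDl mulr_ge0 //.
  by have /andP[] := rb K.
apply: (@le_of_le_add_geometric _ _ _ (1 / (q - 1)) q) => // K.
rewrite (H K) lerD ?psum_le_real // ler_wpM2r //.
by have /andP[] := rb K.
Qed.

(** * Monotonicity and continuity of the value in the base *)

(** The value at [p] stays extended so that p = q_0 = 1 is covered. *)
Lemma value_strict_antimono d p q k : 0 < p -> p < q -> 1 < q -> d k ->
  ((expansion_real d q)%:E < expansion_value d p)%E.
Proof.
move=> p0 pq q1 dk; rewrite ltNge; apply/negP => le.
have H K : psum d p K <= expansion_real d q.
  by rewrite -lee_fin; apply: le_trans le; exact: psum_le_value.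
pose delta := 1 / p ^+ k.+1 - 1 / q ^+ k.+1.
have d0 : 0 < delta.
  rewrite subr_gt0 !div1r ltf_pV2 ?posrE ?exprn_gt0 ?ltrXn2r ?nnegrE //; lra.
suff : expansion_real d q <= expansion_real d q - delta by lra.
apply: (@le_of_le_add_geometric _ _ _ (1 / (q - 1)) q) => // K.
have kL : (k < K + k.+1)%N by lia.
have g1 := psum_gap p0 (ltW pq) dk kL; have g2 := H (K + k.+1)%N.
have g3 := expansion_real_le_psum d (K + k.+1) q1.
have g4 : 1 / (q - 1) / q ^+ (K + k.+1) <= 1 / (q - 1) / q ^+ K.
  rewrite ler_wpM2l ?divr_ge0 ?subr_ge0 ?(ltW q1) //.
  by rewrite lef_pV2 ?posrE ?exprn_gt0 ?ler_eXn2l ?leq_addr //; lra.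
rewrite /delta; lra.
Qed.

Lemma expansion_real_strict_antimono d p q k : 1 < p -> p < q -> d k ->
  expansion_real d q < expansion_real d p.
Proof.
move=> p1 pq dk; rewrite -lte_fin -(expansion_valueE d p1).
by apply: value_strict_antimono dk => //; lra.
Qed.

Lemma expansion_real_antimono d p q : 1 < p -> p <= q ->
  expansion_real d q <= expansion_real d p.
Proof.
move=> p1 pq; apply: expansion_real_le => [|K]; first lra.
by apply: le_trans (psum_le_real d K p1); apply: psum_antimono => //; lra.
Qed.

(** The values of [d] and its complement add up to 1 / (q - 1), and that of the complement also
    decreases with the base. *)
Lemma expansion_real_lipschitz d p q : 1 < p -> p <= q ->
  expansion_real d p - expansion_real d q <= 1 / (p - 1) - 1 / (q - 1).
Proof.
move=> p1 pq; have := expansion_real_antimono (flip d) p1 pq.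
rewrite !expansion_real_flip //; lra.
Qed.

Lemma expansion_real_ivt d a b y : 1 < a -> a <= b ->
  expansion_real d b <= y <= expansion_real d a ->
  exists2 c, a <= c <= b & expansion_real d c = y.
Proof.
move=> a1 ab yab.
(* Freezing the base below [a] makes [f] Lipschitz on the whole line, with constant 1 / (a -
   1)^2. *)
pose f (p : R) := expansion_real d (Num.max a p).
have a10 : 0 < a - 1 by lra.
have key p q : p <= q -> `|f p - f q| <= `|p - q| / (a - 1) ^+ 2.
  move=> pq; rewrite /f.
  have pq' : Num.max a p <= Num.max a q.
    by rewrite ge_max le_max lexx /= le_max pq orbT.
  have P1 : a <= Num.max a p by rewrite le_max lexx.
  have d1 : Num.max a q - Num.max a p <= q - p.
    by rewrite /Num.max; case: (ltP a q) => h1; case: (ltP a p) => h2; lra.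
  move: P1 pq' d1; set P := Num.max a p; set Q := Num.max a q => P1 PQ d1.
  rewrite ger0_norm ?subr_ge0 ?expansion_real_antimono //; last lra.
  rewrite distrC ger0_norm ?subr_ge0 //.
  apply: le_trans (expansion_real_lipschitz _ _ PQ) _; first lra.
  have -> : 1 / (P - 1) - 1 / (Q - 1) = (Q - P) / ((P - 1) * (Q - 1)).
    by field; rewrite !gt_eqF //; lra.
  apply: ler_pM => //; first lra.
    by rewrite invr_ge0 mulr_ge0 //; lra.
  rewrite lef_pV2 ?posrE ?exprn_gt0 ?mulr_gt0 //; try lra.
  by rewrite expr2 ler_pM //; lra.
have cf : continuous f.
  move=> p; apply/cvgrPdist_le => eps eps0; near=> q.
  have E : `|f p - f q| <= `|p - q| / (a - 1) ^+ 2.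
    case: (leP p q) => pq; first exact: key.
    by rewrite distrC [`|p - q|]distrC key // ltW.
  apply: (le_trans E); rewrite ler_pdivrMr ?exprn_gt0 //.
  near: q; apply: cvgr_dist_le; first exact: cvg_id.
  by rewrite mulr_gt0 ?exprn_gt0.
have fE p : a <= p -> f p = expansion_real d p by move=> ap; rewrite /f max_r.
have [||c] := @IVT _ f a b y ab; first exact: continuous_subspaceT.
  rewrite !fE // ge_min le_max; case/andP: yab => -> ->; by rewrite orbT.
by rewrite in_itv /= => /andP[ac cb]; rewrite fE // => e; exists c; rewrite ?ac.
Unshelve. all: by end_near.
Qed.

End PartialSums.

(** * Unique expansions *)

Section UniqueExpansions.
Variable R : realType.
Implicit Types (d e : binseq) (q p x y : R) (m k : nat).

Lemma is_expansionE q x d : 1 < q -> is_expansion q x d <-> expansion_real d q = x.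
Proof.
by move=> q1; rewrite /is_expansion expansion_valueE //; split=> [[]|->].
Qed.

(** The part of [y] left by the first [k] greedy digits, scaled by q^k; the next digit is 1 when
    [1 <= q * r]. *)
Fixpoint greedy_remainder q y k : R :=
  if k is k'.+1 then
    let r := greedy_remainder q y k' in q * r - (1 <= q * r)%R%:R
  else y.

Lemma expansion_exists q y : 1 < q < 2 -> 0 <= y <= 1 / (q - 1) ->
  exists d, expansion_real d q = y.
Proof.
move=> /andP[q1 q2] yb; pose r := greedy_remainder q y.
have q0 : q != 0 by rewrite gt_eqF //; lra.
(* Since q < 2, the remainder after a digit 0, being below 1, stays in range. *)
have i1 : 1 <= 1 / (q - 1) by rewrite ler_pdivlMr; lra.
have rb K : 0 <= r K <= 1 / (q - 1).
  elim: K => // K; rewrite /r /= -/(r K) => /andP[r0 r1].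
  have e : q * (1 / (q - 1)) - 1 = 1 / (q - 1) by field; rewrite gt_eqF //; lra.
  case: (leP 1 (q * r K)) => h; rewrite /=; apply/andP; split; last 1 first.
  - by rewrite subr0; lra.
  - lra.
  - by rewrite -e lerD2r ler_pM2l //; lra.
  by rewrite subr0 mulr_ge0 //; lra.
exists (fun K => 1 <= q * r K); apply: (@expansion_real_eq_of_psum _ _ _ _ r) => // K.
elim: K => [|K IH]; first by rewrite psum0 add0r expr0 divr1.
rewrite psumS /r /= -/(r K) {1}IH exprS; field.
by rewrite expf_neq0 ?q0.
Qed.

Lemma rtailE d k : rtail d k = if d k then flip (tail_from d k.+1) else tail_from d k.+1.
Proof.
apply/funext => i; rewrite /rtail -addSnnS.
by case: (d k); rewrite ?addbT ?addbF.
Qed.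

Lemma expansion_real_split d q k : 1 < q -> expansion_real d q =
  psum d q k + ((d k)%:R + expansion_real (tail_from d k.+1) q) / q ^+ k.+1.
Proof. by move=> q1; rewrite (expansion_real_add d k.+1) // psumS mulrDl addrA. Qed.

(** Otherwise flipping [d k] and expanding the rest anew gives a second expansion. *)
Lemma unique_rtail_lt1 q x d k : 1 < q < 2 -> is_expansion q x d ->
  unique_expansion q x -> expansion_real (rtail d k) q < 1.
Proof.
move=> q12 xd [d0 [_ uq]]; have /andP[q1 q2] := q12.
rewrite ltNge; apply/negP => ge1.
(* [y] is what the tail must be worth after the flip; the assumed bound puts it in
   [0, 1 / (q - 1)]. *)
pose s := tail_from d k.+1; pose y := expansion_real s q + (d k)%:R - (~~ d k)%:R.
have s0 := expansion_real_ge0 s q1; have s1 := expansion_real_le_max s q1.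
have [e re] : exists e, expansion_real e q = y.
  apply: expansion_exists => //; move: ge1; rewrite rtailE /y -/s.
  case: (d k) => /=; rewrite ?expansion_real_flip //; lra.
pose g : binseq := fun i => if (i < k)%N then d i else
  if i == k then ~~ d k else e (i - k.+1)%N.
have gk : g k = ~~ d k by rewrite /g ltnn eqxx.
suff gd : is_expansion q x g.
  have : d k = g k by rewrite -(uq _ xd) -(uq _ gd).
  by rewrite gk; case: (d k).
apply/is_expansionE => //; move/(is_expansionE _ _ q1): xd => <-.
rewrite (expansion_real_split g k) // (expansion_real_split d k) // gk.
have -> : psum g q k = psum d q k by apply: eq_psum => i ik; rewrite /g ik.
have -> : tail_from g k.+1 = e.
  apply/funext => i; rewrite /tail_from /g addKn ltnNge ltnW ?gtn_eqF //; lia.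
by rewrite re /y -/s; congr (_ + _ / _); ring.
Qed.

(** At the first difference from another expansion, the tail of [d] or its complement would have to
    make up for a whole unit. *)
Lemma rtail_lt1_unique q x d : 1 < q -> is_expansion q x d ->
  (forall k, expansion_real (rtail d k) q < 1) -> unique_expansion q x.
Proof.
move=> q1 xd H; exists d; split=> // e xe; apply: contrapT => ne.
have ex : exists i, d i != e i.
  apply: contrapT => nex; apply: ne; apply/funext => i.
  by apply/eqP/negPn/negP => h; apply: nex; exists i.
case: (ex_minnP ex) => k nk kmin.
have ag i : (i < k)%N -> d i = e i.
  move=> ik; apply/eqP/negPn/negP => h.
  by have := kmin _ h; rewrite leqNgt ik.
move/(is_expansionE _ _ q1): xd; move/(is_expansionE _ _ q1): xe => <-.
rewrite (expansion_real_split d k) // (expansion_real_split e k) // (eq_psum _ ag) => /addrI.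
have qk : (q ^+ k.+1)^-1 != 0 by rewrite invr_eq0 expf_neq0 // gt_eqF //; lra.
move=> /(mulIf qk); have := H k; rewrite rtailE.
have s0 := expansion_real_ge0 (tail_from e k.+1) q1.
have s1 := expansion_real_le_max (tail_from e k.+1) q1.
move: nk; case: (d k); case: (e k) => //= _; rewrite ?expansion_real_flip //; lra.
Qed.

(** At the first difference [d] has a 0, and its tail there is worth less than the digit 1 of
    [e]. *)
Lemma expansion_real_lex_le q d e : 1 < q -> (forall k, expansion_real (rtail d k) q < 1) ->
  lex_le d e -> expansion_real d q <= expansion_real e q.
Proof.
move=> q1 H [->//|[k [ag [dk ek]]]].
rewrite (expansion_real_split d k) // (expansion_real_split e k) // (eq_psum _ ag) lerD2l.
rewrite ler_pM2r ?invr_gt0 ?exprn_gt0 //; last lra.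
have := H k; rewrite rtailE dk ek /=; have := expansion_real_ge0 (tail_from e k.+1) q1; lra.
Qed.

(** * The bases q_m and the univoque sequences between them *)

Lemma tmw_sumE n q :
  \sum_(1 <= i < (2 ^ n).+1) (thue_morse i)%:R / q ^+ i = psum tmw q (2 ^ n).
Proof. by rewrite big_add1. Qed.

(** The sum exceeds 1 in base 1, where tau_1 = tau_2 = 1 already give 2, and is below 1 in base 2,
    so [xget] finds a root. The value q_0 = 1 solves the equation for m = 0. *)
Lemma tm_base_spec m : [/\ 1 <= tm_base R m, tm_base R m < 2,
  (0 < m)%N -> 1 < tm_base R m & psum tmw (tm_base R m) (2 ^ m) = 1].
Proof.
case: m => [|m].
  split=> //; first by rewrite ltr1n.
  by rewrite /psum big_nat1 /tmw /= expr1 divr1.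
rewrite /tm_base; case: xgetP => [q -> [/andP[q1 q2] qe]|nex].
  by rewrite -tmw_sumE; split=> //; exact: ltW.
exfalso.
have two : 1 < psum tmw (1 : R) (2 ^ m.+1).
  apply: (@lt_le_trans _ _ (psum tmw (1 : R) 2)).
    by rewrite /psum big_nat_recr // big_nat1 /= !expr1n /tmw /=; lra.
  by apply: psum_le_mono => //; rewrite expnS leq_pmulr ?expn_gt0.
have lt1 : psum tmw (2 : R) (2 ^ m.+1) < 1.
  have h : (1 : R) < 2 by rewrite ltr1n.
  have := psum_flip tmw (2 ^ m.+1) h; set K := (2 ^ m.+1)%N.
  have : 0 <= psum (flip tmw) (2 : R) K by apply: psum_ge0; lra.
  have -> : (2 : R) - 1 = 1 by ring.
  have : (0 : R) < 1 / 2 ^+ K by rewrite divr_gt0 ?exprn_gt0.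
  rewrite divr1; lra.
have [|||q /andP[q1 q2] qe] := @psum_ivt R tmw 1 2 1 (2 ^ m.+1); first by [].
- by rewrite ler1n.
- by rewrite !ltW.
apply: (nex q) => /=; rewrite tmw_sumE qe; split=> //.
rewrite !lt_neqAle q1 q2 !andbT; apply/andP; split; apply/eqP => e.
  by rewrite -e in qe; move: two; rewrite qe ltxx.
by rewrite e in qe; move: lt1; rewrite qe ltxx.
Qed.

Lemma tm_sum_lt1 m q : tm_base R m < q -> psum tmw q (2 ^ m) < 1.
Proof.
move=> lt; have [b1 _ _ <-] := tm_base_spec m.
by apply: (@psum_strict_antimono _ _ _ _ 0); rewrite ?expn_gt0 //; lra.
Qed.

(** At q_m the longer sum exceeds 1, as it adds at least the term of tau_{2^(m+1)} = 1. *)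
Lemma tm_base_lt m : tm_base R m < tm_base R m.+1.
Proof.
have [b1 _ _ e1] := tm_base_spec m; have [c1 _ _ e2] := tm_base_spec m.+1.
rewrite ltNge; apply/negP => le.
have := psum_antimono tmw (2 ^ m.+1) (lt_le_trans ltr01 c1) le; rewrite e2.
have q0 : 0 < tm_base R m by lra.
have p0 : (0 < 2 ^ m.+1)%N by rewrite expn_gt0.
rewrite -[in X in X -> _](prednK p0) psumS tmw_last.
have : psum tmw (tm_base R m) (2 ^ m) <= psum tmw (tm_base R m) (2 ^ m.+1).-1.
  by apply: psum_le_mono => //; rewrite expnS; have := expn_gt0 2 m; lia.
rewrite e1 => h; have : 0 < true%:R / tm_base R m ^+ (2 ^ m.+1).-1.+1.
  by rewrite divr_gt0 ?exprn_gt0.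
lra.
Qed.

Lemma tm_base_between n q : 1 < q <= tm_base R n ->
  exists2 k, (1 <= k <= n)%N & tm_base R k.-1 < q <= tm_base R k.
Proof.
elim: n => [|n IH] /andP[q1 qn]; first by move: qn => /=; lra.
have [lt|gt] := ltP (tm_base R n) q; first by exists n.+1; rewrite ?ltnSn //= lt.
have [|k /andP[k1 kn] hk] := IH; first by rewrite q1.
by exists k => //; rewrite k1 ltnW.
Qed.

(* Cutting [rtail d k] at the first digit below [tmw] leaves again some
   [rtail d k'], so the geometric error term gains a factor 1/q. *)
Lemma tm_bounded_rtail_lt1 m q d k : tm_base R m < q -> tm_bounded m d ->
  expansion_real (rtail d k) q < 1.
Proof.
move=> mq bd; have [b1 _ _ _] := tm_base_spec m; have q1 : 1 < q by lra.
have q0 : 0 < q by lra.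
apply: le_lt_trans (tm_sum_lt1 mq).
apply: (@le_of_le_add_geometric _ _ _ (1 / (q - 1)) q) => // K.
have C0 : 0 <= 1 / (q - 1) by rewrite divr_ge0 //; lra.
have step K' k' : (forall k, expansion_real (rtail d k) q <= 1 + 1 / (q - 1) / q ^+ K') ->
    expansion_real (rtail d k') q <= psum tmw q (2 ^ m) + 1 / (q - 1) / q ^+ K'.+1.
  move=> IH; have [j [jm ag tj rj]] := bd k'.
  rewrite (expansion_real_split _ j) // rj add0r (eq_psum _ ag).
  have -> : tail_from (rtail d k') j.+1 = rtail d (k' + j.+1).
    by apply/funext => i; rewrite /tail_from rtail_add.
  have := psum_le_mono tmw q0 jm; rewrite psumS tj => le.
  have qj : 0 < (q ^+ j.+1)^-1 by rewrite invr_gt0 exprn_gt0.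
  have := IH (k' + j.+1)%N; rewrite -(ler_pM2r qj) mulrDl.
  have : 1 / (q - 1) / q ^+ K' / q ^+ j.+1 <= 1 / (q - 1) / q ^+ K'.+1.
    rewrite -mulrA -invfM -exprD ler_wpM2l // lef_pV2 ?posrE ?exprn_gt0 //.
    by rewrite ler_eXn2l //; lia.
  move: le => /=; lra.
have all K' : forall k', expansion_real (rtail d k') q <= 1 + 1 / (q - 1) / q ^+ K'.
  elim: K' => [|K' IH] k'.
    by rewrite expr0 divr1; have := expansion_real_le_max (rtail d k') q1; lra.
  by apply: le_trans (step K' k' IH) _; have := tm_sum_lt1 mq; lra.
apply: le_trans (step K k (all K)) _; rewrite lerD2l ler_wpM2l //.
by rewrite lef_pV2 ?posrE ?exprn_gt0 // ler_eXn2l.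
Qed.

(** At its first difference from [tmw] the shift has 0 against 1, by [thue_morse_shift_lt]; its
    remaining digits, worth at most 1 by induction, do not outweigh that missing 1. *)
Lemma tm_shift_sum_le1 n q m L : 0 < q -> psum tmw q (2 ^ n) <= 1 ->
  (L <= 2 ^ n)%N -> psum (tail_from tmw m) q L <= 1.
Proof.
move=> q0 le1; elim/ltn_ind: L m => L IH m Ln.
have mono K : (K <= 2 ^ n)%N -> psum tmw q K <= 1.
  by move=> Kn; apply: le_trans le1; apply: psum_le_mono.
have [ag|nag] := pselect (forall i, (i < L)%N -> tail_from tmw m i = tmw i).
  by rewrite (eq_psum _ ag) mono.
have ex : exists i, (i < L)%N && (tail_from tmw m i != tmw i).
  apply: contrapT => nex; apply: nag => i iL.
  by apply/eqP/negPn/negP => h; apply: nex; exists i; rewrite iL.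
case: (ex_minnP ex) => j /andP[jL ne] jmin.
have ag i : (i < j)%N -> tail_from tmw m i = tmw i.
  move=> ij; apply/eqP/negPn/negP => h; have := jmin i; rewrite h.
  by rewrite (ltn_trans ij jL) leqNgt ij => /(_ isT).
have tj : tmw j = true.
  apply: (@thue_morse_shift_lt m); rewrite ?addnS //.
  by case=> // i ij; rewrite addnS; apply: ag.
have sj : tail_from tmw m j = false by move: ne; rewrite tj; case: tail_from.
rewrite -(subnKC jL) psum_add // psumS sj mul0r addr0 (eq_psum _ ag).
have := mono _ (leq_trans jL Ln); rewrite psumS tj; apply: le_trans.
rewrite lerD2l ler_pM2r ?invr_gt0 ?exprn_gt0 //.
have -> : tail_from (tail_from tmw m) j.+1 = tail_from tmw (m + j.+1).
  by apply/funext => i; rewrite /tail_from addnA.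
by apply: IH; lia.
Qed.

(** By [tm_shift_sum_le1], a 1 at place [j] outweighs the digits of [tmw] after it. Hence words
    violating [tm_boundedP] have value at least 1. *)
Lemma tm_prefix_ge1 n q j : 0 < q -> psum tmw q (2 ^ n) = 1 -> (j < 2 ^ n)%N ->
  tmw j = false \/ j = (2 ^ n).-1 -> 1 <= psum tmw q j + 1 / q ^+ j.+1.
Proof.
move=> q0 e1 jn [tj|je].
  have := psum_add tmw j.+1 (2 ^ n - j.+1) q0; rewrite subnKC // e1.
  move=> e; rewrite [X in X <= _]e.
  rewrite psumS tj mul0r addr0 lerD2l ler_pM2r ?invr_gt0 ?exprn_gt0 //.
  by apply: (@tm_shift_sum_le1 n); rewrite ?e1 ?leq_subr.
have p0 : (0 < 2 ^ n)%N by rewrite expn_gt0.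
by move: e1; rewrite -(prednK p0) psumS tmw_last je => ->.
Qed.

(** At b = q_{m+1}, where values are smaller still, level [m.+1] follows from [tm_prefix_ge1]. Were
    level [m] to fail, some tail would repeat tau_1 ... tau_{2^(m+1)-1} 0 forever, which is worth 1
    in base b. *)
Lemma rtail_lt1_tm_bounded m q d : 1 < q -> q <= tm_base R m.+1 ->
  (forall k, expansion_real (rtail d k) q < 1) -> tm_bounded m d.
Proof.
move=> q1 qm lt1; have [_ _ /(_ isT) b1 e1] := tm_base_spec m.+1.
move: b1 qm e1; set b := tm_base R m.+1 => b1 qm e1.
have b0 : 0 < b by lra.
have {}lt1 k : expansion_real (rtail d k) b < 1.
  by apply: le_lt_trans (lt1 k); exact: expansion_real_antimono.
have bd : tm_bounded m.+1 d.
  apply/tm_boundedP => k j jm ag tj; case rj: (rtail d k j) => //; exfalso.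
  have := tm_prefix_ge1 b0 e1 jm tj; have := psum_le_real (rtail d k) j.+1 b1.
  by rewrite psumS rj (eq_psum _ ag) /=; have := lt1 k; lra.
apply: contrapT => nbd; have [k0 bk0] := tm_block_of_not_bounded bd nbd.
suff : 1 <= expansion_real (rtail d k0) b by rewrite leNgt lt1.
apply: (@le_of_le_add_geometric _ _ _ 1 b) => // s.
elim: s k0 bk0 => [|s IH] k bk.
  by rewrite expr0 divr1; have := expansion_real_ge0 (rtail d k) b1; lra.
have [ag last] := tm_block_double bd bk.
have p0 : (0 < 2 ^ m.+1)%N by rewrite expn_gt0.
have bk2 := tm_blocks 2 bd bk.
have e2 : (2 * 2 ^ m = 2 ^ m.+1)%N by rewrite expnS.
rewrite e2 in bk2; have := IH _ bk2.
rewrite (expansion_real_add (rtail d k) (2 ^ m.+1)) //.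
have -> : tail_from (rtail d k) (2 ^ m.+1) = rtail d (k + 2 ^ m.+1).
  by apply/funext => i; rewrite /tail_from -{1 2}(prednK p0) rtail_add // prednK.
(* The period differs from the word of sum 1 only by its last digit. *)
have -> : psum (rtail d k) b (2 ^ m.+1) = 1 - 1 / b ^+ (2 ^ m.+1).
  rewrite -{1}e1 -(prednK p0) !psumS last tmw_last (eq_psum _ ag) /=; ring.
have bN : 0 < (b ^+ (2 ^ m.+1))^-1 by rewrite invr_gt0 exprn_gt0.
rewrite -(ler_pM2r bN) mulrDl.
have : 1 / b ^+ s / b ^+ (2 ^ m.+1) <= 1 / b ^+ s.+1.
  rewrite -mulrA -invfM -exprD ler_wpM2l // lef_pV2 ?posrE ?exprn_gt0 //.
  by rewrite ler_eXn2l //; lia.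
lra.
Qed.

Lemma unique_expansion_tm_bounded m q x d :
  tm_base R m < q <= tm_base R m.+1 -> is_expansion q x d ->
  unique_expansion q x <-> tm_bounded m d.
Proof.
move=> /andP[mq qm] xd; have [b1 _ _ _] := tm_base_spec m.
have [_ b2 _ _] := tm_base_spec m.+1.
split=> [uq|bd].
  apply: (@rtail_lt1_tm_bounded m q) => //; first lra.
  by move=> k; apply: unique_rtail_lt1 xd uq; apply/andP; split; lra.
apply: (rtail_lt1_unique _ xd) => [|k]; first lra.
exact: tm_bounded_rtail_lt1 bd.
Qed.

Lemma univoque_sequences_tm_base m d :
  univoque_sequences (tm_base R m.+1) d <-> tm_bounded m d.
Proof.
have mq : tm_base R m < tm_base R m.+1 <= tm_base R m.+1.
  by rewrite tm_base_lt lexx.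
have [_ b2 /(_ isT) b1 _] := tm_base_spec m.+1.
split=> [[x [_ uq] xd]|bd]; first exact/(unique_expansion_tm_bounded mq xd).
have xd : is_expansion (tm_base R m.+1) (expansion_real d (tm_base R m.+1)) d.
  exact/is_expansionE.
exists (expansion_real d (tm_base R m.+1)) => //.
split; first by rewrite expansion_real_ge0 ?expansion_real_le_max.
exact/(unique_expansion_tm_bounded mq xd).
Qed.

End UniqueExpansions.

(** * The smallest univoque base *)

Lemma expansion_real_gt0_digit (R : realType) (d : binseq) (q : R) :
  1 < q -> 0 < expansion_real d q -> exists k, d k.
Proof.
move=> q1; rewrite ltNge => /negP npos; apply: contrapT => nex; apply: npos.
apply: expansion_real_le => // K; rewrite /psum big1 // => i _.
by case: (boolP (d i)) => [di|_]; [case: nex; exists i | rewrite mul0r].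
Qed.

(* The lexicographic infimum could fail to belong to the set only by having
   value exactly [x] in base q_m; being then a non-isolated point of level [m],
   it is of level [m - 1], so that [x] is univoque in base q_m. *)
Lemma lex_smallest_exists (R : realType) (m : nat) (x : R) :
  (forall q, 1 < q <= tm_base R m -> ~ unique_expansion q x) ->
  [set d | tm_bounded m d /\ (x%:E < expansion_value d (tm_base R m))%E] !=set0 ->
  exists g, lex_smallest
    [set d | tm_bounded m d /\ (x%:E < expansion_value d (tm_base R m))%E] g.
Proof.
move=> nuq /lex_inf_exists[g [gp gle]]; exists g; split=> //.
have bg : tm_bounded m g.
  by apply: tm_bounded_closed => K; have [d [bd _] dg] := gp K; exists d.
split=> //; case: m => [|m] in nuq gp gle bg *.
  have [d [bd xd] dg] := gp 1%N.
  by rewrite -(tm_bounded0_eq bd bg (dg 0%N isT)).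
have [bm|nbm] := pselect (tm_bounded m g); last first.
  have [K iso] := tm_bounded_isolated bg nbm.
  by have [d [bd xd] dg] := gp K; rewrite -(iso d bd dg).
have [_ _ /(_ isT) b1 _] := tm_base_spec R m.+1.
rewrite expansion_valueE // lte_fin lt_neqAle; apply/andP; split.
  apply/eqP => xg; apply: (nuq (tm_base R m.+1)); first by rewrite b1 lexx.
  apply/(@unique_expansion_tm_bounded _ m _ _ g) => //.
    by rewrite tm_base_lt lexx.
  exact/is_expansionE.
(* Every prefix of [g] begins a sequence of value above [x], so the value of [g] is at least [x]. *)
apply: (@le_of_le_add_geometric _ _ _ (1 / (tm_base R m.+1 - 1)) (tm_base R m.+1)) => // K.
have [d [_ xd] dg] := gp K; move: xd; rewrite expansion_valueE // lte_fin.
have := expansion_real_le_psum d K b1; rewrite (eq_psum _ dg).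
have := psum_le_real g K b1; lra.
Qed.

(* Right lower semicontinuity at p, where the value may be infinite (p = 1). *)
Lemma value_gt_right (R : realType) (d : binseq) (p q x : R) :
  1 <= p -> p < q -> expansion_real d q <= x -> (x%:E < expansion_value d p)%E ->
  exists2 r, p < r <= q & x <= expansion_real d r.
Proof.
move=> p1 pq qx xp.
have [K xK] : exists K, x < psum d p K.
  apply: contrapT => nex; move: xp; rewrite ltNge => /negP; apply.
  apply: value_le => [|K]; first lra.
  by rewrite leNgt; apply/negP => h; apply: nex; exists K.
(* The midpoint lies strictly below the partial sum at [p], which keeps [r] off [p]. *)
pose y := (x + psum d p K) / 2.
have q1 : 1 < q by lra.
have [|||r /andP[pr rq] ry] := @psum_ivt _ d p q y K; [lra|lra| |].
  have := psum_le_real d K q1; rewrite /y => h; apply/andP; split; lra.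
have {}pr : p < r.
  rewrite lt_neqAle pr andbT; apply/eqP => e; move: ry; rewrite -e /y; lra.
exists r; first by rewrite pr.
have r1 : 1 < r by lra.
have := psum_le_real d K r1; rewrite ry /y; lra.
Qed.

Theorem theorem5p2 (R : realType) (n : nat) (x : R) (n_ge1 : (1 <= n)%N)
    (x_gt0 : 0 < x)
    (x_layer : (@univoque_layer R n `\`
       \bigcup_(k in [set k | (1 <= k <= n.-1)%N]) @univoque_layer R k) x) :
  tm_base R n.-1 < smallest_univoque_base x <= tm_base R n /\
  exists gamma : binseq,
    lex_smallest
      [set d | univoque_sequences (tm_base R n) d /\
               (x%:E < expansion_value d (tm_base R n.-1))%E] gamma /\
    [set q : R | tm_base R n.-1 < q <= tm_base R n /\
                 x%:E = expansion_value gamma q]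
      = [set smallest_univoque_base x].
Proof.
case: n n_ge1 x_layer => // m _; rewrite [m.+1.-1]/= => -[[q1 q1m [_ uq1]] nlayer].
have [b1 _ _ _] := tm_base_spec R m; have [_ c2 _ _] := tm_base_spec R m.+1.
(* Such a base would put [x] in an earlier layer. *)
have nuq q : 1 < q <= tm_base R m -> ~ unique_expansion q x.
  move=> qm uq; have [k km qk] := tm_base_between qm; case: nlayer; exists k => //.
  exists q => //; split=> //; case: uq => d [xd _].
  have /andP[q0 _] := qm.
  by move/(is_expansionE _ _ q0): xd => <-; rewrite expansion_real_ge0 ?expansion_real_le_max.
have mem q d : tm_base R m < q <= tm_base R m.+1 -> is_expansion q x d ->
    unique_expansion q x ->
    tm_bounded m d /\ (x%:E < expansion_value d (tm_base R m))%E.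
  move=> qm xd uq; split; first exact/(unique_expansion_tm_bounded qm xd).
  have /andP[mq _] := qm; have q0 : 1 < q by lra.
  move/(is_expansionE _ _ q0): xd => xd.
  have [|k dk] := @expansion_real_gt0_digit _ d q q0; first by rewrite xd.
  by rewrite -xd; apply: value_strict_antimono dk => //; lra.
have -> : [set d | univoque_sequences (tm_base R m.+1) d /\
    (x%:E < expansion_value d (tm_base R m))%E] =
  [set d | tm_bounded m d /\ (x%:E < expansion_value d (tm_base R m))%E].
  by apply/seteqP; split=> d /= [/univoque_sequences_tm_base].
have [d1 [xd1 _]] := uq1.
have [g [Sg gmin]] := lex_smallest_exists nuq (ex_intro _ d1 (mem _ _ q1m xd1 uq1)).
have [bg xg] := Sg.
(* The expansion of [x] in a univoque base lies in the set minimized by [g], so [g] is worth at most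
   [x] there. *)
have below q : tm_base R m < q <= tm_base R m.+1 -> unique_expansion q x ->
    expansion_real g q <= x.
  move=> qm uq; have [d [xd _]] := uq; have /andP[mq _] := qm.
  have q0 : 1 < q by lra.
  move/(is_expansionE _ _ q0): (xd) => <-; apply: expansion_real_lex_le => // [k|].
    exact: tm_bounded_rtail_lt1 bg.
  by apply: gmin; exact: mem xd uq.
have /andP[mq1 q1m1] := q1m.
(* The intermediate value theorem needs a left end [r] beyond q_m, where the value is finite. *)
have [r /andP[mr rq1] xr] := value_gt_right b1 mq1 (below _ q1m uq1) xg.
have [|||s /andP[rs sq1] gs] := @expansion_real_ivt _ g r q1 x; [lra|lra| |].
  by rewrite xr below.
have s1 : 1 < s by lra.
have sm : tm_base R m < s <= tm_base R m.+1 by apply/andP; split; lra.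
have xs : is_expansion s x g by exact/is_expansionE.
have us : unique_expansion s x by exact/(unique_expansion_tm_bounded sm xs).
have [k gk] : exists k, g k by apply: (@expansion_real_gt0_digit _ g s) => //; rewrite gs.
(* In a smaller univoque base [g] would be worth at most [x], against strict decrease in the
   base. *)
have smin q : univoque_bases x q -> s <= q.
  move=> [/andP[q0 _] uq]; rewrite leNgt; apply/negP => qs.
  have mq : tm_base R m < q.
    by rewrite ltNge; apply/negP => qm; apply: (nuq q) => //; rewrite q0.
  have qm : tm_base R m < q <= tm_base R m.+1 by apply/andP; split; lra.
  have := below q qm uq; rewrite -gs leNgt => /negP; apply.
  exact: expansion_real_strict_antimono gk.
have Us : univoque_bases x s by split=> //; apply/andP; split; lra.
have -> : smallest_univoque_base x = s.
  apply/eqP; rewrite eq_le; apply/andP; split.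
    by apply: ge_inf => //; exists s => q /smin.
  by apply: lb_le_inf => [|q /smin //]; exists s.
split=> //; exists g; split=> //; apply/seteqP; split=> [q [/andP[mq qm]]|q ->] //=.
have q0 : 1 < q by lra.
move=> /(is_expansionE _ _ q0) gq; apply/eqP; rewrite eq_le !leNgt.
apply/andP; split; apply/negP => lt.
  by have := expansion_real_strict_antimono s1 lt gk; rewrite gs gq ltxx.
by have := expansion_real_strict_antimono q0 lt gk; rewrite gs gq ltxx.
Qed.
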